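(* Let $n\ge1$ be an integer and let $\mu$ be a probability distribution on $[0,1]^{\mathbb N}$. For $i\ge1$ let $\sigma^2(i)=\mathrm{Var}_{X\sim\mu}(X(i))$ be the variance of coordinate $i$, and suppose that the sequence $(\sigma^2(i))_{i\ge1}$ is non-increasing. Then, with universal constants in all the relations $\lesssim$: (i) If $\sigma^2(j)\le\frac1{2nj}$ for all $j\ge1$, then $$\Delta_n(\mu)\lesssim\frac1n\wedge\sqrt{\frac{\sum_{j\ge1}\sigma^2(j)}{n}}.$$ (ii) Otherwise, $$\Delta_n(\mu)\lesssim1\wedge\sup_{j\ge1}\left(\sqrt{\frac{\sigma^2(j)\ln(j+1)}{n}}\vee\frac{\ln(j+1)}{n\ln\left(2+\frac{\ln(j+1)}{n\sigma^2(j)}\right)}\right).$$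
   Context: Notation: $a\vee b=\max(a,b)$, $a\wedge b=\min(a,b)$; $A\lesssim B$ means $A\le CB$ for a universal constant $C>0$ (independent of $n$, $\mu$). Coordinates under $\mu$ may be dependent. With $\boldsymbol p=\mathbb E_{X\sim\mu}[X]$, i.i.d. samples $X_1,\dots,X_n\sim\mu$ and $\hat{\boldsymbol p}_n=\frac1n\sum_{i=1}^nX_i$, $\Delta_n(\mu)=\mathbb E\|\hat{\boldsymbol p}_n-\boldsymbol p\|_\infty=\mathbb E\sup_{j\ge1}|\hat p_n(j)-p(j)|$. When $\sigma^2(j)=0$ the term $\frac{\ln(j+1)}{n\ln(2+\ln(j+1)/(n\sigma^2(j)))}$ is interpreted as $0$. *)

(* Defs.v *)
From HB Require Import structures.
From mathcomp Require Import all_boot all_order all_algebra.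
From mathcomp Require Import all_classical all_reals all_analysis.
Set Implicit Arguments.
Unset Strict Implicit.
Unset Printing Implicit Defensive.
Import Order.TTheory GRing.Theory Num.Theory.
Import numFieldNormedType.Exports.
Local Open Scope classical_set_scope.
Local Open Scope ring_scope.

HB.instance Definition _ (R : realType) := isPointed.Build {i01 R} 0%:i01.

(* The measurable space [0,1]^N with its product sigma-algebra.  Coordinates
   are indexed from 0: index j below is the (j+1)-st coordinate, so a formula
   written with 1-based index j appears here with j.+1 in place of j. *)
Definition cylinders (R : realType) : set (set (nat -> {i01 R})) :=
  \bigcup_j preimage_set_system setT
    (fun x : nat -> {i01 R} => (x j)%:num) measurable.

Arguments cylinders R : clear implicits.

Notation cube R := (g_sigma_algebraType (cylinders R)).

Definition coordinate (R : realType) (j : nat) (x : cube R) : R := (x j)%:num.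

Definition mean (R : realType) (mu : probability (cube R) R) (j : nat) : R :=
  fine ('E_mu[@coordinate R j])%E.

Definition sigma2 (R : realType) (mu : probability (cube R) R) (j : nat) : R :=
  fine ('V_mu[@coordinate R j])%E.

Definition independent_RVs d (Omega : measurableType d) d' (T : measurableType d')
    (R : realType) (P : probability Omega R) (n : nat)
    (X : 'I_n -> {RV P >-> T}) : Prop :=
  forall (J : {set 'I_n}) (A : 'I_n -> set T),
    (forall i, measurable (A i)) ->
    P (\bigcap_(i in [set` J]) (X i @^-1` A i)) =
    (\prod_(i in J) P (X i @^-1` A i))%E.

Definition iid_samples d (Omega : measurableType d) d' (T : measurableType d')
    (R : realType) (P : probability Omega R) (mu : probability T R) (n : nat)
    (X : 'I_n -> {RV P >-> T}) : Prop :=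
  independent_RVs X /\
  forall i (A : set T), measurable A -> distribution P (X i) A = mu A.

Definition empirical_mean d (Omega : measurableType d) (R : realType)
    (P : probability Omega R) (n : nat) (X : 'I_n -> {RV P >-> cube R})
    (j : nat) (w : Omega) : R :=
  n%:R^-1 * \sum_(i < n) coordinate j (X i w).

(* The expected sup-norm deviation computed on samples X_1, ..., X_n drawn on a
   probability space (Omega, P); for i.i.d. samples of law mu its value depends
   only on n and mu. *)
Definition Delta d (Omega : measurableType d) (R : realType)
    (P : probability Omega R) (mu : probability (cube R) R) (n : nat)
    (X : 'I_n -> {RV P >-> cube R}) : \bar R :=
  (\int[P]_w ereal_sup
     (range (fun j => `|empirical_mean X j w - mean mu j|%:E)))%E.

(* At zero variance the expression is 0 by convention; Rocq's [x / 0 = 0]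
   would instead give ln(j+2) / (n ln 2). *)
Definition poisson_term (R : realType) (n : nat) (s2 : R) (j : nat) : R :=
  if s2 == 0 then 0
  else ln j.+2%:R / (n%:R * ln (2 + ln j.+2%:R / (n%:R * s2))).

(* Main.v *)
(** Let S_j be the sum over the sample of the centered j-th coordinates and
    v_j = n sigma^2(j).  The summands are bounded by 1, so Bennett's inequality
    bounds the moment generating function of +-S_j by exp (v_j psi(l)), where
    psi(l) = e^l - 1 - l.  For any b >= 0 and any rates l_j > 0,
      sup_j |S_j| <= b + sum_j (e^{l_j (S_j - b)} + e^{l_j (- S_j - b)}) / l_j,
    so n Delta <= b + 2 K once
      exp (v_j psi(l_j) - l_j b) / l_j <= K / (j+1)^2 for all j >= 1.
    In case (i) one takes b = 2 and l_j = ln (2j); the bound by the square root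
    follows instead from sup_j |S_j| <= t + sum_j S_j^2 / t.  In case (ii), with
    T equal to n times the supremum, one takes b = 5T, and l_j is
    ln (2 + ln(j+1)/v_j) or sqrt (ln(j+1)/v_j) according to whether v_j is
    below or above ln(j+1).  The failure of the hypothesis of (i) gives T >= 1/4,
    which absorbs the factors 1/l_j into T. *)
Require Import Defs.
From HB Require Import structures.
From mathcomp Require Import all_boot all_order all_algebra.
From mathcomp Require Import ring lra measurable_realfun.
From mathcomp Require Import all_classical all_reals all_analysis.
Set Implicit Arguments.
Unset Strict Implicit.
Unset Printing Implicit Defensive.
Import Order.TTheory GRing.Theory Num.Theory.
Import numFieldNormedType.Exports.
Local Open Scope classical_set_scope.
Local Open Scope ring_scope.

(** * Moment generating functions of sums of i.i.d. variables *)

(* For k >= 2 and |y| <= 1, |(l y)^k| <= y^2 l^k; compare the series. *)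
Lemma expR_le_quadratic (R : realType) (l y : R) : 0 <= l -> `|y| <= 1 ->
  expR (l * y) <= 1 + l * y + y ^+ 2 * (expR l - 1 - l).
Proof.
move=> l0 y1.
(* The added constant replaces the terms of order 0 and 1 by 1 + l y, so only orders at least 2
   remain to be compared. *)
pose h n := y ^+ 2 * series (exp_coeff l) n + (1 + l * y - y ^+ 2 * (1 + l)).
have cl : series (exp_coeff l) @ \oo --> expR l by exact: is_cvg_series_exp_coeff.
have ch : h @ \oo --> y ^+ 2 * expR l + (1 + l * y - y ^+ 2 * (1 + l)).
  by apply: cvgD; [apply: cvgM => //; exact: cvg_cst|exact: cvg_cst].
have -> : 1 + l * y + y ^+ 2 * (expR l - 1 - l) =
    y ^+ 2 * expR l + (1 + l * y - y ^+ 2 * (1 + l)) by ring.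
rewrite -(cvg_lim _ ch)//.
apply: ler_lim; [exact: is_cvg_series_exp_coeff|by apply/cvg_ex; eexists; exact: ch|].
near=> n.
have n2 : (2 <= n)%N by near: n; exists 2%N.
rewrite /h /series /= !(@big_cat_nat _ _ _ 2 0 n)//= !big_nat_recr//= !(@big_geq _ _ _ 0 0)//.
rewrite /exp_coeff/= !expr0 !expr1 !fact0 !divr1 !add0r.
have : \sum_(2 <= i < n) (l * y) ^+ i / i`!%:R <=
   y ^+ 2 * \sum_(2 <= i < n) l ^+ i / i`!%:R.
  rewrite mulr_sumr big_nat_cond [leRHS]big_nat_cond; apply: ler_sum => i.
  rewrite andbT => /andP[i2 _].
  rewrite mulrA ler_pM2r ?invr_gt0 ?ltr0n ?fact_gt0//.
  rewrite exprMn mulrC ler_wpM2r ?exprn_ge0//.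
  rewrite (le_trans (ler_norm _))// normrX -(subnK i2) exprD.
  by rewrite -[y ^+ 2]real_normK ?num_real// ler_piMl ?exprn_ile1 ?sqr_ge0.
lra.
Unshelve. all: by end_near. Qed.

(** The vector of classes [k (X i w)] takes finitely many values [phi]. Summing over the events
    [A phi], independence factors each probability, and distributivity turns the sum over all [phi]
    into an n-th power. *)
Lemma iid_integral_prod_finite d (Omega : measurableType d) d'
    (T : measurableType d') (R : realType) (P : probability Omega R)
    (mu : probability T R) (n : nat) (X : 'I_n -> {RV P >-> T})
    (m : nat) (c : 'I_m -> R) (k : T -> 'I_m) :
  iid_samples mu X ->
  (forall a, 0 <= c a) -> (forall a, measurable (k @^-1` [set a])) ->
  (\int[P]_w (\prod_(i < n) c (k (X i w)))%:E =
   ((\sum_a c a * fine (mu (k @^-1` [set a]))) ^+ n)%:E)%E.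
Proof.
move=> [indX distX] c0 mk.
pose A (phi : {ffun 'I_n -> 'I_m}) :=
  \bigcap_(i in [set` [set: 'I_n]%SET]) (X i @^-1` (k @^-1` [set phi i])).
have mX i a : measurable (X i @^-1` (k @^-1` [set a])).
  by rewrite -[X in measurable X]setTI; exact: (measurable_funP (X i)).
have mA phi : measurable (A phi).
  by apply: fin_bigcap_measurable => //; exact: finite_finset.
have -> : (\int[P]_w (\prod_(i < n) c (k (X i w)))%:E =
    \int[P]_w (\sum_(phi : {ffun 'I_n -> 'I_m})
      ((\prod_i c (phi i))%:E * (\1_(A phi) w)%:E)))%E.
  apply: eq_integral => w _.
  (* The events [A phi] partition [Omega]: only the class vector of [w] itself contributes. *)
  rewrite (bigD1 [ffun i => k (X i w)])//= [X in _ = (_ + X)%E]big1 ?adde0.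
    rewrite indicE mem_set /A/=; last by move=> i _; rewrite /= ffunE.
    by rewrite mule1; congr EFin; apply: eq_bigr => i _; rewrite ffunE.
  move=> phi; apply: contraNeq => /eqP h; apply/eqP/ffunP => i.
  rewrite ffunE; apply: contrapT => nk; apply: h.
  rewrite indicE memNset ?mule0// => /(_ i); rewrite /= inE => /(_ isT) /esym.
  exact: nk.
rewrite ge0_integral_sum//; last 2 first.
- by move=> phi; apply/measurable_EFinP/measurable_funM => //; exact: measurable_indic.
- by move=> phi w _; rewrite -EFinM lee_fin mulr_ge0// prodr_ge0.
rewrite [LHS](_ : _ = (\sum_(phi : {ffun 'I_n -> 'I_m})
    \prod_i (c (phi i) * fine (mu (k @^-1` [set phi i]))))%:E)%E.
  rewrite -(bigA_distr_bigA (fun i a => c a * fine (mu (k @^-1` [set a]))))/=.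
  by rewrite prodr_const card_ord.
rewrite -sumEFin; apply: eq_bigr => phi _.
rewrite ge0_integralZl_EFin ?prodr_ge0//; last first.
  by apply/measurable_EFinP; exact: measurable_indic.
rewrite integral_indic// setIT big_split/= EFinM; congr (_ * _)%E.
rewrite /A indX; last by move=> i; exact: mk.
rewrite -prodEFin; apply: eq_big => [i|i _]; first by rewrite inE.
rewrite fineK ?fin_num_measure// -(distX i) //.
Qed.

Lemma iid_integral_prod_le d (Omega : measurableType d) d'
    (T : measurableType d') (R : realType) (P : probability Omega R)
    (mu : probability T R) (n : nat) (X : 'I_n -> {RV P >-> T})
    (f : T -> R) (B M : R) :
  iid_samples mu X -> measurable_fun setT f ->
  (forall x, 0 <= f x <= B) -> (\int[mu]_x (f x)%:E <= M%:E)%E ->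
  (\int[P]_w (\prod_(i < n) f (X i w))%:E <= (M ^+ n)%:E)%E.
Proof.
move=> iidX mf f0B fM.
have f0 x : 0 <= f x by case/andP: (f0B x).
have M0 : 0 <= M by rewrite -lee_fin (le_trans _ fM)// integral_ge0// => x _; rewrite lee_fin.
have mprod : measurable_fun setT (fun w => (\prod_(i < n) f (X i w))%:E).
  by apply/measurable_EFinP/measurable_prod => i _; exact: measurableT_comp.
(* A rounding error e in f raises its mean by at most e; the loss disappears as e tends to 0 from
   the right, by continuity of the n-th power. *)
suff H e : 0 < e -> (\int[P]_w (\prod_(i < n) f (X i w))%:E <= ((M + e) ^+ n)%:E)%E.
  have cM : (M + x) ^+ n @[x --> 0^'+] --> M ^+ n.
    apply: (@cvg_comp _ _ _ (fun x => M + x) (fun y => y ^+ n) _ (nbhs M)); last first.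
      exact: exprn_continuous.
    apply: cvg_at_right_filter; rewrite -[X in _ --> X]addr0.
    by apply: cvgD; [exact: cvg_cst|exact: cvg_id].
  have Ifin : (\int[P]_w (\prod_(i < n) f (X i w))%:E)%E \is a fin_num.
    rewrite ge0_fin_numE ?integral_ge0//; last first.
      by move=> w _; rewrite lee_fin prodr_ge0.
    by rewrite (le_lt_trans (H 1 ltr01))// ltry.
  rewrite -(fineK Ifin) lee_fin -(cvg_lim _ cM)//.
  apply: limr_ge; first by apply/cvg_ex; eexists; exact: cM.
  near=> e; rewrite -lee_fin fineK//; apply: H.
  by near: e; exact: nbhs_right_gt.
(* Round f up to the next multiple of e, which gives a function with finitely
   many values. *)
move=> e0.
(* Since f <= B, every truncated quotient is below [m], so [inord] does not fall back to its default
   value. *)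
pose m := (Num.truncn (B / e)).+1.
pose k (x : T) : 'I_m := inord (Num.truncn (f x / e)).
have kE x : (k x = Num.truncn (f x / e) :> nat)%N.
  rewrite inordK// ltnS le_truncn// ler_pM2r ?invr_gt0//.
  by case/andP: (f0B x).
pose c (a : 'I_m) : R := a.+1%:R * e.
have fc x : f x <= c (k x) <= f x + e.
  have fe0 : 0 <= f x / e by rewrite divr_ge0// ltW.
  rewrite /c kE; apply/andP; split.
    by rewrite -ler_pdivrMr// ltW// truncnS_gt.
  rewrite -natr1 mulrDl mul1r lerD2r -ler_pdivlMr//.
  by rewrite truncn_le.
have mk a : measurable (k @^-1` [set a]).
  rewrite (_ : k @^-1` _ = f @^-1` `[a%:R * e, a.+1%:R * e[).
    by rewrite -[X in measurable X]setTI; exact: mf.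
  apply/seteqP; split => x /=; rewrite in_itv/= -ler_pdivlMr// -ltr_pdivrMr//.
    move=> <-; rewrite kE truncn_le ?truncnS_gt// divr_ge0// ltW//.
  move=> h; apply: val_inj; rewrite /= kE; apply/truncn_def => //.
have ckE x : c (k x) = \sum_a c a * \1_(k @^-1` [set a]) x.
  rewrite (bigD1 (k x))//= big1 ?addr0.
    by rewrite indicE mem_set ?mulr1.
  by move=> a /eqP ka; rewrite indicE memNset ?mulr0//= => /esym.
have mck : measurable_fun setT (c \o k).
  rewrite (_ : c \o k = fun x => \sum_a c a * \1_(k @^-1` [set a]) x); last exact/funext.
  by apply: measurable_sum => a; apply: measurable_funM => //; exact: measurable_indic.
have c0 a : 0 <= c a by rewrite mulr_ge0// ltW.
apply: (@le_trans _ _ (\int[P]_w (\prod_(i < n) c (k (X i w)))%:E)%E).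
  apply: ge0_le_integral => //.
  - by move=> w _; rewrite lee_fin prodr_ge0.
  - apply/measurable_EFinP/measurable_prod => i _.
    exact: (measurableT_comp mck).
  - move=> w _; rewrite lee_fin; apply: ler_prod => i _; rewrite f0/=.
    by case/andP: (fc (X i w)).
rewrite (iid_integral_prod_finite iidX)// lee_fin lerXn2r ?nnegrE//.
- by rewrite sumr_ge0// => a _; rewrite mulr_ge0// fine_ge0.
- by rewrite addr_ge0// ltW.
rewrite -lee_fin; apply: (@le_trans _ _ (\int[mu]_x (c (k x))%:E)%E).
  under eq_integral do rewrite ckE -sumEFin.
  rewrite ge0_integral_sum//; last 2 first.
  - move=> a; apply/measurable_EFinP/measurable_funM => //; exact: measurable_indic.
  - by move=> a x _; rewrite lee_fin mulr_ge0.
  rewrite -sumEFin; apply: lee_sum => a _.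
  under eq_integral do rewrite EFinM.
  rewrite ge0_integralZl_EFin//; last first.
    by apply/measurable_EFinP; exact: measurable_indic.
  by rewrite integral_indic// setIT EFinM fineK// fin_num_measure.
rewrite EFinD -[X in (_ <= _ + X)%E](_ : \int[mu]_x (cst e%:E) x = _)%E; last first.
  by rewrite integral_cst//= probability_setT mule1.
apply: (@le_trans _ _ (\int[mu]_x (f x)%:E + \int[mu]_x (cst e%:E) x)%E); last by rewrite leeD2r.
have mf' : measurable_fun setT (EFin \o f) by apply/measurable_EFinP.
rewrite -ge0_integralD//; last 2 first.
- by move=> x _; rewrite lee_fin.
- by move=> x _; rewrite lee_fin ltW.
apply: ge0_le_integral => //.
- by move=> x _; rewrite lee_fin.
- by apply/measurable_EFinP.
- by apply: emeasurable_funD => //; exact/measurable_EFinP.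
by move=> x _; rewrite -EFinD lee_fin; case/andP: (fc x).
Unshelve. all: by end_near. Qed.

Lemma probability_integral_cst d (T : measurableType d) (R : realType)
    (mu : probability T R) (c : R) : (\int[mu]_x c%:E = c%:E)%E.
Proof.
rewrite -[RHS]mule1 -(probability_setT mu).
exact: (integral_cst mu measurableT c%:E).
Qed.

Lemma bounded_integrable d (T : measurableType d) (R : realType)
    (mu : probability T R) (f : T -> R) (K : R) :
  measurable_fun setT f -> (forall x, `|f x| <= K) ->
  mu.-integrable setT (EFin \o f).
Proof.
move=> mf fK; apply: measurable_bounded_integrable => //.
  by rewrite -ge0_fin_numE// fin_num_measure.
exists K; split; first exact: num_real.
by move=> x Kx y _ /=; exact: le_trans (fK y) (ltW Kx).
Qed.

(** Integrating [expR_le_quadratic] kills the linear term because f is centered; 1 + x <= e^x then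
    gives a form that multiplies well over the sample. *)
Lemma integral_expR_le d (T : measurableType d) (R : realType)
    (mu : probability T R) (f : T -> R) (s2 l : R) :
  measurable_fun setT f -> (forall x, `|f x| <= 1) ->
  (\int[mu]_x (f x)%:E = 0)%E -> (\int[mu]_x (f x ^+ 2)%:E = s2%:E)%E ->
  0 <= l ->
  (\int[mu]_x (expR (l * f x))%:E <= (expR (s2 * (expR l - 1 - l)))%:E)%E.
Proof.
move=> mf f1 f0 fs l0; set psi := expR l - 1 - l.
have if1 : mu.-integrable setT (EFin \o f) by apply: (@bounded_integrable _ _ _ mu f 1 mf f1).
have if2 : mu.-integrable setT (EFin \o (fun x => f x ^+ 2)).
  apply: (@bounded_integrable _ _ _ _ _ 1); first exact: measurable_funX.
  by move=> x; rewrite normrX exprn_ile1.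
have i1 : mu.-integrable setT (EFin \o cst 1%R).
  by apply: (@bounded_integrable _ _ _ _ _ 1) => // x; rewrite /= normr1.
apply: (@le_trans _ _ (1 + s2 * psi)%:E); last by rewrite lee_fin expR_ge1Dx.
have -> : ((1 + s2 * psi)%:E = \int[mu]_x (1 + l * f x + psi * f x ^+ 2)%:E)%E.
  under eq_integral do rewrite !EFinD !EFinM.
  rewrite integralD//; last 2 first.
  - by apply: integrableD => //; exact: integrableZl.
  - exact: integrableZl.
  rewrite integralD//; last exact: integrableZl.
  rewrite !integralZl// f0 fs mule0 adde0 probability_integral_cst.
  by rewrite -EFinM -EFinD mulrC.
apply: ge0_le_integral => //.
- apply/measurable_EFinP; apply: (measurableT_comp (@measurable_expR R)).
  exact: measurable_funM.
- apply/measurable_EFinP/measurable_funD.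
    by apply: measurable_funD => //; exact: measurable_funM.
  by apply: measurable_funM => //; exact: measurable_funX.
- by move=> x _; rewrite lee_fin [psi * _]mulrC expR_le_quadratic.
Qed.

Lemma iid_expR_sum_le d (Omega : measurableType d) d'
    (T : measurableType d') (R : realType) (P : probability Omega R)
    (mu : probability T R) (n : nat) (X : 'I_n -> {RV P >-> T})
    (f : T -> R) (s2 l : R) :
  iid_samples mu X -> measurable_fun setT f -> (forall x, `|f x| <= 1) ->
  (\int[mu]_x (f x)%:E = 0)%E -> (\int[mu]_x (f x ^+ 2)%:E = s2%:E)%E ->
  0 <= l ->
  (\int[P]_w (expR (l * \sum_(i < n) f (X i w)))%:E <=
   (expR (n%:R * s2 * (expR l - 1 - l)))%:E)%E.
Proof.
move=> iidX mf f1 f0 fs l0.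
under eq_integral do rewrite mulr_sumr expR_sum.
rewrite -mulrA expRM_natl.
apply: (iid_integral_prod_le (f := fun x => expR (l * f x)) (B := expR l) iidX).
- by apply: (measurableT_comp (@measurable_expR R)); exact: measurable_funM.
- move=> x; rewrite expR_ge0 ler_expR ler_piMr// (le_trans (ler_norm _))//.
- exact: integral_expR_le.
Qed.

(** * Deviations of the coordinates *)

Lemma measurable_coordinate (R : realType) (j : nat) :
  measurable_fun setT (@coordinate R j).
Proof.
move=> _ A mA; rewrite setTI; apply: sub_sigma_algebra; exists j => //.
by exists A => //; rewrite setTI.
Qed.

Lemma coordinate_ge0 (R : realType) j (x : cube R) : 0 <= coordinate j x.
Proof. by rewrite /coordinate. Qed.

Lemma coordinate_le1 (R : realType) j (x : cube R) : coordinate j x <= 1.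
Proof. by rewrite /coordinate. Qed.

Section deviation.
Context (R : realType) (mu : probability (cube R) R).

Definition deviation (j : nat) (x : cube R) : R := coordinate j x - mean mu j.

Lemma measurable_deviation j : measurable_fun setT (deviation j).
Proof. by apply: measurable_funB => //; exact: measurable_coordinate. Qed.

Lemma integrable_coordinate j : mu.-integrable setT (EFin \o @coordinate R j).
Proof.
apply: (@bounded_integrable _ _ _ _ _ 1); first exact: measurable_coordinate.
by move=> x; rewrite ger0_norm ?coordinate_ge0 ?coordinate_le1.
Qed.

Lemma integral_coordinate j : (\int[mu]_x (coordinate j x)%:E = (mean mu j)%:E)%E.
Proof.
rewrite /mean unlock fineK//; apply: integrable_fin_num => //.
exact: integrable_coordinate.
Qed.

Lemma mean_itv j : 0 <= mean mu j <= 1.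
Proof.
rewrite -2!lee_fin -integral_coordinate; apply/andP; split.
  by apply: integral_ge0 => x _; rewrite lee_fin coordinate_ge0.
rewrite -[leRHS](probability_integral_cst mu).
apply: ge0_le_integral => //.
- by move=> x _; rewrite lee_fin coordinate_ge0.
- by apply/measurable_EFinP; exact: measurable_coordinate.
- by move=> x _; rewrite lee_fin coordinate_le1.
Qed.

Lemma deviation_le1 j x : `|deviation j x| <= 1.
Proof.
have := mean_itv j; have := coordinate_ge0 j x; have := coordinate_le1 j x.
rewrite /deviation ler_norml; lra.
Qed.

Lemma integral_deviation j : (\int[mu]_x (deviation j x)%:E = 0)%E.
Proof.
rewrite /deviation; under eq_integral do rewrite EFinB.
rewrite integralB//; last 2 first.
- exact: integrable_coordinate.
- by apply: (@bounded_integrable _ _ _ _ (cst (mean mu j)) `|mean mu j|).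
by rewrite integral_coordinate probability_integral_cst subee.
Qed.

Lemma integral_deviation_sqr j :
  (\int[mu]_x (deviation j x ^+ 2)%:E = (sigma2 mu j)%:E)%E.
Proof.
have ifin : (\int[mu]_x (deviation j x ^+ 2)%:E)%E \is a fin_num.
  apply: integrable_fin_num => //.
  apply: (@bounded_integrable _ _ _ _ _ 1).
    by apply: measurable_funX; exact: measurable_deviation.
  by move=> x; rewrite normrX exprn_ile1// deviation_le1.
rewrite -(fineK ifin) /sigma2 /variance /deviation /mean.
by rewrite covariance.unlock !expectation.unlock.
Qed.

Lemma sigma2_ge0 j : 0 <= sigma2 mu j.
Proof.
by rewrite -lee_fin -integral_deviation_sqr integral_ge0// => x _; rewrite lee_fin sqr_ge0.
Qed.

End deviation.

Lemma nneseries_le (R : realType) (u : nat -> R) (c : R) :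
  (forall j, 0 <= u j) -> (forall m, \sum_(0 <= j < m) u j <= c) ->
  (\sum_(0 <= j <oo) (u j)%:E <= c%:E)%E.
Proof.
move=> u0 uc; apply: lime_le.
  by apply: is_cvg_nneseries => j _ _; rewrite lee_fin.
by apply: nearW => m; rewrite sumEFin lee_fin.
Qed.

(** Telescoping, from 1/(m+2)^2 <= 1/(m+1) - 1/(m+2). *)
Lemma sum_inv_sqr_le (R : realType) (m : nat) :
  \sum_(0 <= j < m) (j.+2%:R ^+ 2)^-1 <= 1 :> R.
Proof.
suff : \sum_(0 <= j < m) (j.+2%:R ^+ 2)^-1 <= 1 - m.+1%:R^-1 :> R.
  by move=> /le_trans; apply; rewrite gerBl invr_ge0.
elim: m => [|m IH]; first by rewrite big_geq// invr1 subrr.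
rewrite big_nat_recr//=; apply: (le_trans (lerD IH (lexx _))).
rewrite -[m.+2]addn1 -[m.+1]addn1 !natrD; set a : R := m%:R.
have a0 : 0 <= a by rewrite /a.
suff : ((a + 1 + 1) ^+ 2)^-1 <= (a + 1)^-1 - (a + 1 + 1)^-1 by lra.
have -> : (a + 1)^-1 - (a + 1 + 1)^-1 = ((a + 1) * (a + 1 + 1))^-1 by field; lra.
rewrite lef_pV2 ?posrE; nra.
Qed.

(** * Sums of deviations over the sample, and the expected supremum as a series *)

Section sample_deviation.
Context d (Omega : measurableType d) (R : realType) (P : probability Omega R).
Context (mu : probability (cube R) R) (n : nat) (X : 'I_n -> {RV P >-> cube R}).

Definition sample_deviation j w : R := \sum_(i < n) deviation mu j (X i w).
Local Notation S := sample_deviation.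

Lemma measurable_sample_deviation j : measurable_fun setT (S j).
Proof.
apply: measurable_sum => i.
exact: (measurableT_comp (measurable_deviation mu j)).
Qed.

Lemma empirical_meanB j w : (0 < n)%N ->
  empirical_mean X j w - mean mu j = n%:R^-1 * S j w.
Proof.
move=> n0; rewrite /empirical_mean /S /deviation sumrB mulrBr.
rewrite [X in _ = _ - _ * X]sumr_const card_ord -[mean mu j *+ n]mulr_natl mulKf//.
by rewrite pnatr_eq0 -lt0n.
Qed.

(** As the [g j] are nonnegative, their sum dominates each of them, hence n times the supremum is at
    most b plus the sum, whatever the dependence between coordinates. The series is then integrated
    term by term. *)
Lemma Delta_le_series (b : R) (g : nat -> Omega -> R) :
  (0 < n)%N -> 0 <= b ->
  (forall j, measurable_fun setT (g j)) -> (forall j w, 0 <= g j w) ->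
  (forall j w, `|S j w| <= b + g j w) ->
  (Delta mu X <= n%:R^-1%:E *
     (b%:E + \sum_(0 <= j <oo) \int[P]_w (g j w)%:E))%E.
Proof.
move=> n0 b0 mg g0 Sg; rewrite /Delta.
have mEg j : measurable_fun setT (fun w => (g j w)%:E) by apply/measurable_EFinP.
have msum : measurable_fun setT (fun w => \sum_(0 <= j <oo) (g j w)%:E)%E.
  by apply: ge0_emeasurable_sum => // j w _ _; rewrite lee_fin.
rewrite -integral_nneseries//; last by move=> j w _; rewrite lee_fin.
rewrite -(probability_integral_cst P b) -ge0_integralD//; last first.
  by move=> w _; apply: nneseries_ge0 => j _ _; rewrite lee_fin.
rewrite -ge0_integralZl_EFin//; last 2 first.
- move=> w _; rewrite adde_ge0 ?lee_fin//.
  by apply: nneseries_ge0 => j _ _; rewrite lee_fin.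
- exact: emeasurable_funD.
apply: ge0_le_integral => //.
- move=> w _; apply: le_trans (ereal_sup_ubound _); last by exists 0%N.
  by rewrite lee_fin.
(* Measurability of the supremum comes from viewing it as the tail supremum starting at index 0. *)
- rewrite (_ : (fun _ => _) = fun w =>
      esups (fun j => `|empirical_mean X j w - mean mu j|%:E) 0); last first.
    apply/funext => w; congr ereal_sup.
    by apply/seteqP; split => x [k _ <-]; exists k.
  apply: measurable_fun_esups => j; apply/measurable_EFinP/measurableT_comp => //.
  under eq_fun do rewrite empirical_meanB//.
  by apply: measurable_funM => //; exact: measurable_sample_deviation.
- by apply: measurable_funeM; exact: emeasurable_funD.
move=> w _; apply: ge_ereal_sup => _ [j _ <-].
rewrite empirical_meanB// normrM ger0_norm ?invr_ge0// EFinM.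
apply: lee_pmul => //.
apply: (@le_trans _ _ (b + g j w)%:E); first by rewrite lee_fin.
rewrite EFinD leeD2l//.
have := @nneseries_lim_ge _ (fun j => (g j w)%:E) xpredT 0 j.+1.
rewrite big_nat_recr//= => h; apply: le_trans (h _); last by move=> *; rewrite lee_fin.
by rewrite leeDr// sume_ge0// => *; rewrite lee_fin.
Qed.

Context (iidX : iid_samples mu X).

Lemma integral_expR_sample_deviation_le j l : 0 <= l ->
  (\int[P]_w (expR (l * S j w))%:E <=
   (expR (n%:R * sigma2 mu j * (expR l - 1 - l)))%:E)%E.
Proof.
move=> l0; apply: (iid_expR_sum_le iidX _ (deviation_le1 mu j)) => //.
- exact: measurable_deviation.
- exact: integral_deviation.
- exact: integral_deviation_sqr.
Qed.

(** The negated deviation is again centered, bounded by 1 and of the same second moment. *)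
Lemma integral_expRN_sample_deviation_le j l : 0 <= l ->
  (\int[P]_w (expR (l * - S j w))%:E <=
   (expR (n%:R * sigma2 mu j * (expR l - 1 - l)))%:E)%E.
Proof.
move=> l0; under eq_integral do rewrite /S -sumrN.
apply: (iid_expR_sum_le (f := fun x => - deviation mu j x) iidX) => //.
- by apply: measurableT_comp => //; exact: measurable_deviation.
- by move=> x; rewrite normrN deviation_le1.
- under eq_integral do rewrite -mulN1r EFinM.
  rewrite integralZl ?integral_deviation ?mule0//.
  apply: (@bounded_integrable _ _ _ mu _ 1); first exact: measurable_deviation.
  exact: deviation_le1.
- under eq_integral do rewrite sqrrN.
  exact: integral_deviation_sqr.
Qed.

End sample_deviation.

(** * Exponential bound on the expected supremum *)

(** Squaring e^{-1/2} >= 1 - 1/2 gives e^{-1} >= 1/4. *)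
Lemma expR1_le4 (R : realType) : expR 1 <= 4 :> R.
Proof.
have h : 2^-1 <= expR (- 2^-1) :> R by apply: le_trans (expR_ge1Dx _); lra.
have e1 : expR 1 * (expR (- 2^-1) * expR (- 2^-1)) = 1 :> R.
  by rewrite -!expRD; rewrite (_ : 1 + _ = 0) ?expR0//; field.
have h4 : 4^-1 <= expR (- 2^-1) * expR (- 2^-1) :> R by nra.
have := ler_wpM2l (expR_ge0 (1 : R)) h4; rewrite e1; lra.
Qed.

Lemma ln2_ge_half (R : realType) : 2^-1 <= ln 2 :> R.
Proof.
rewrite -ler_expR lnK ?posrE//.
have e : expR 2^-1 * expR 2^-1 = expR 1 :> R by rewrite -expRD; congr expR; field.
have := expR1_le4 R; have := expR_gt0 (2^-1 : R); rewrite -e; nra.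
Qed.

Lemma expR_remainder_le (R : realType) (x : R) : 0 <= x <= 1 ->
  expR x - 1 - x <= 2 * x ^+ 2.
Proof.
move=> /andP[x0 x1]; have := @expR_le_quadratic R 1 x ler01.
rewrite ger0_norm// mul1r => /(_ x1).
have := expR1_le4 R; nra.
Qed.

(** The constant 8 completes a square: 4 (e^x + e^{-x}) - 8 = 4 (e^{x/2} - e^{-x/2})^2, and for x >=
    0 the difference in parentheses is at least x/2. *)
Lemma sqr_le_expR (R : realType) (x : R) : x ^+ 2 + 8 <= 4 * (expR x + expR (- x)).
Proof.
wlog x0 : x / 0 <= x.
  move=> H; have [/H//|/ltW xn] := leP 0 x.
  by rewrite -sqrrN [X in 4 * X]addrC -[x in X in 4 * (_ + X)]opprK H// oppr_ge0.
set a := expR (x / 2); set b := expR (- (x / 2)).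
have ea : expR x = a ^+ 2 by rewrite expr2 -expRD; congr expR; field.
have eb : expR (- x) = b ^+ 2 by rewrite expr2 -expRD; congr expR; field.
have ab : a * b = 1 by rewrite -expRD subrr expR0.
have a1 : 1 + x / 2 <= a by exact: expR_ge1Dx.
have b1 : b <= 1 by rewrite expR_le1; lra.
rewrite ea eb.
have h : x / 2 <= a - b by lra.
have h0 : 0 <= x / 2 by lra.
have : (x / 2) * (x / 2) <= (a - b) * (a - b) by apply: ler_pM.
nra.
Qed.

(** With y = l_j (|S_j| - b), the inequality y <= e^y bounds |S_j| - b by e^y / l_j, and e^{l|S|} <=
    e^{lS} + e^{-lS} removes the absolute value. The two signs account for the factor 2; the inverse
    squares sum to at most 1. *)
Lemma Delta_le_expR d (Omega : measurableType d) (R : realType)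
    (P : probability Omega R) (mu : probability (cube R) R) (n : nat)
    (X : 'I_n -> {RV P >-> cube R}) (b K : R) (l : nat -> R) :
  iid_samples mu X -> (0 < n)%N -> 0 <= b -> (forall j, 0 < l j) ->
  (forall j, (l j)^-1 *
     expR (n%:R * sigma2 mu j * (expR (l j) - 1 - l j) - l j * b) <=
     K * (j.+2%:R ^+ 2)^-1) ->
  (Delta mu X <= (n%:R^-1 * (b + 2 * K))%:E)%E.
Proof.
move=> iidX n0 b0 l0 lK.
(* The sign of [K] is read off the hypothesis [lK] at index 0, whose left side is nonnegative. *)
have K0 : 0 <= K.
  have := lK 0%N; set a := expR _.
  have : 0 <= (l 0%N)^-1 * a by rewrite mulr_ge0 ?expR_ge0// invr_ge0 ltW.
  by move=> /le_trans h /h; rewrite pmulr_lge0// invr_gt0 exprn_gt0.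
pose S := sample_deviation mu X.
pose c j := (l j)^-1 * expR (- (l j * b)).
have c0 j : 0 <= c j by rewrite mulr_ge0 ?expR_ge0// invr_ge0 ltW.
have mS j : measurable_fun setT (S j) by exact: measurable_sample_deviation.
have me j : measurable_fun setT (fun w => expR (l j * S j w)).
  by apply: (measurableT_comp (@measurable_expR R)); exact: measurable_funM.
have meN j : measurable_fun setT (fun w => expR (l j * - S j w)).
  apply: (measurableT_comp (@measurable_expR R)); apply: measurable_funM => //.
  exact: measurableT_comp.
pose g j w := c j * (expR (l j * S j w) + expR (l j * - S j w)).
apply: (le_trans (@Delta_le_series _ _ _ _ mu n X b g n0 b0 _ _ _)).
- by move=> j; apply: measurable_funM => //; exact: measurable_funD.
- by move=> j w; rewrite mulr_ge0// addr_ge0// expR_ge0.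
- move=> j w; rewrite -lerBlDl -/S.
  have : 1 + l j * (`|S j w| - b) <= expR (l j * `|S j w|) * expR (- (l j * b)).
    by rewrite -expRD -mulrBr expR_ge1Dx.
  have : expR (l j * `|S j w|) <= expR (l j * S j w) + expR (l j * - S j w).
    have [_|_] := ler0P (S j w); first by rewrite lerDr expR_ge0.
    by rewrite lerDl expR_ge0.
  move=> h1 h2; rewrite /g /c -mulrA -ler_pdivrMl ?invr_gt0// invrK mulrC.
  apply: le_trans (_ : 1 + l j * (`|S j w| - b) <= _); first by rewrite mulrC lerDr.
  by apply: (le_trans h2); rewrite mulrC ler_wpM2l// expR_ge0.
have n10 : 0 <= n%:R^-1 :> R by rewrite invr_ge0.
rewrite EFinM; apply: lee_pmul => //.
  rewrite adde_ge0 ?lee_fin//; apply: nneseries_ge0 => j _ _.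
  by apply: integral_ge0 => w _; rewrite lee_fin mulr_ge0// addr_ge0// expR_ge0.
rewrite EFinD leeD2l//.
apply: (@le_trans _ _ (\sum_(0 <= j <oo) (2 * K * (j.+2%:R ^+ 2)^-1)%:E)%E).
  apply: lee_nneseries.
    move=> j _ _; apply: integral_ge0 => w _.
    by rewrite lee_fin mulr_ge0// addr_ge0// expR_ge0.
  move=> j _; rewrite /g; under eq_integral do rewrite EFinM EFinD.
  rewrite ge0_integralZl_EFin//; last 2 first.
  - by move=> w _; rewrite adde_ge0// lee_fin expR_ge0.
  - by apply: emeasurable_funD; apply/measurable_EFinP.
  rewrite ge0_integralD//; last 2 first.
  - by apply/measurable_EFinP.
  - by apply/measurable_EFinP.
  have h1 := integral_expR_sample_deviation_le iidX j (ltW (l0 j)).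
  have h2 := integral_expRN_sample_deviation_le iidX j (ltW (l0 j)).
  apply: (le_trans (lee_wpmul2l _ (leeD h1 h2))); first by rewrite lee_fin.
  rewrite -EFinD -EFinM lee_fin; move: (lK j).
  rewrite expRD /c; set a := expR (_ * _); set a' := expR (- _).
  set q := (_ ^+ 2)^-1; set r := (l j)^-1 => h.
  have -> : r * a' * (a + a) = 2 * (r * (a * a')) by ring.
  by rewrite -mulrA ler_pM2l.
apply: nneseries_le => [j|m].
  by rewrite !mulr_ge0// invr_ge0 exprn_ge0.
rewrite -mulr_sumr ler_piMr ?mulr_ge0//.
exact: sum_inv_sqr_le.
Qed.

(** * The two regimes *)

(** Multiplied by t, this follows from (a - t)^2 >= 0. It splits |S_j| into a common threshold and a
    term whose mean is summable with the variances. *)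
Lemma le_add_sqr_div (R : realFieldType) (a t : R) :
  0 < t -> a <= t + t^-1 * a ^+ 2.
Proof.
move=> t0; rewrite -(ler_pM2r t0).
have -> : (t + t^-1 * a ^+ 2) * t = t ^+ 2 + a ^+ 2 by field; lra.
by have := sqr_ge0 (a - t); have := sqr_ge0 a; have := sqr_ge0 t; nra.
Qed.

Section small_variances.
Context d (Omega : measurableType d) (R : realType) (P : probability Omega R).
Context (mu : probability (cube R) R) (n : nat) (X : 'I_n -> {RV P >-> cube R}).
Context (iidX : iid_samples mu X) (n0 : (0 < n)%N).

(** The second moment is recovered, up to a constant, from the exponential moments at rate 1. *)
Lemma integral_sample_deviation_sqr_le j : n%:R * sigma2 mu j <= 2^-1 ->
  (\int[P]_w (sample_deviation mu X j w ^+ 2)%:E <=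
   (48 * (n%:R * sigma2 mu j))%:E)%E.
Proof.
set S := sample_deviation mu X; set v := n%:R * _ => v2.
have v0 : 0 <= v by rewrite mulr_ge0// sigma2_ge0.
have mS : measurable_fun setT (S j) by exact: measurable_sample_deviation.
have mS2 : measurable_fun setT (fun w => (S j w ^+ 2)%:E).
  by apply/measurable_EFinP/measurable_funX.
have me : measurable_fun setT (fun w => expR (S j w)) by exact: measurableT_comp.
have meN : measurable_fun setT (fun w => expR (- S j w)).
  by apply: measurableT_comp => //; exact: measurableT_comp.
have h1 := integral_expR_sample_deviation_le iidX j ler01.
have h2 := integral_expRN_sample_deviation_le iidX j ler01.
(* S^2 + 8 <= 4 (e^S + e^{-S}), integrated with the bound at rate l = 1. *)
have h : (\int[P]_w (S j w ^+ 2)%:E + 8%:E <=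
    4%:E * ((expR (v * (expR 1 - 1 - 1)))%:E + (expR (v * (expR 1 - 1 - 1)))%:E))%E.
  rewrite -(probability_integral_cst P 8) -ge0_integralD//; last first.
    by move=> w _; rewrite lee_fin sqr_ge0.
  apply: (@le_trans _ _ (\int[P]_w (4%:E * ((expR (1 * S j w))%:E + (expR (1 * - S j w))%:E)))%E).
    apply: ge0_le_integral => //.
    - by move=> w _; rewrite adde_ge0// lee_fin sqr_ge0.
    - exact: emeasurable_funD.
    - apply: measurable_funeM; apply: emeasurable_funD; apply/measurable_EFinP.
        by under eq_fun do rewrite mul1r.
      by under eq_fun do rewrite mul1r.
    - by move=> w _; rewrite !mul1r -!EFinD lee_fin sqr_le_expR.
  have me' : measurable_fun setT (fun w => (expR (1 * S j w))%:E).
    by apply/measurable_EFinP; under eq_fun do rewrite mul1r.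
  have meN' : measurable_fun setT (fun w => (expR (1 * - S j w))%:E).
    by apply/measurable_EFinP; under eq_fun do rewrite mul1r.
  rewrite ge0_integralZl_EFin//; last 2 first.
  - by move=> w _; rewrite adde_ge0// lee_fin expR_ge0.
  - exact: emeasurable_funD.
  rewrite ge0_integralD//.
  by apply: lee_wpmul2l; [rewrite lee_fin|exact: leeD].
have ifin : (\int[P]_w (S j w ^+ 2)%:E)%E \is a fin_num.
  rewrite ge0_fin_numE; last by apply: integral_ge0 => w _; rewrite lee_fin sqr_ge0.
  apply: le_lt_trans (ltry (4 * (expR (v * (expR 1 - 1 - 1)) + expR (v * (expR 1 - 1 - 1))))).
  by apply: le_trans h; rewrite leeDl// lee_fin.
move: h; rewrite -(fineK ifin) -!EFinD -EFinM !lee_fin => h.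
have e4 := expR1_le4 R.
(* Here x = v (e - 2) <= 2v <= 1, so the second moment is at most 8 (e^x - 1) <= 8 (x + 2x^2) <= 24x
   <= 48v. *)
set x := v * _ in h.
have x0 : 0 <= x.
  by rewrite mulr_ge0//; have := expR_ge1Dx (1 : R); lra.
have x2 : x <= 2 * v by rewrite /x; nra.
have := @expR_remainder_le R x; rewrite x0 => /(_ _) h3.
have : expR x - 1 - x <= 2 * x ^+ 2 by apply: h3; lra.
nra.
Qed.

(** The bound t + 48 W / t is balanced at t = sqrt W, where it equals 49 sqrt W. *)
Lemma Delta_le_sqrt_sum (W : R) :
  (forall j, n%:R * sigma2 mu j <= 2^-1) ->
  (\sum_(0 <= j <oo) (n%:R * sigma2 mu j)%:E = W%:E)%E ->
  (Delta mu X <= (49 * (n%:R^-1 * Num.sqrt W))%:E)%E.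
Proof.
move=> v2 sumW.
have v0 j : 0 <= n%:R * sigma2 mu j by rewrite mulr_ge0// sigma2_ge0.
have W0 : 0 <= W.
  by rewrite -lee_fin -sumW nneseries_ge0// => j _ _; rewrite lee_fin.
have n1 : 0 <= n%:R^-1 :> R by rewrite invr_ge0.
apply/lee_addgt0Pr => e e0.
(* The extra n e keeps t positive when W = 0, and costs only e after division by n. *)
pose t := Num.sqrt W + n%:R * e.
have ne0 : 0 < n%:R * e by rewrite mulr_gt0// ltr0n.
have t0 : 0 < t by rewrite ltr_wpDl// sqrtr_ge0.
pose S := sample_deviation mu X.
pose g j w := t^-1 * S j w ^+ 2.
have g0 j w : 0 <= g j w by rewrite mulr_ge0 ?sqr_ge0// invr_ge0 ltW.
have mS2 j : measurable_fun setT (fun w => S j w ^+ 2).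
  by apply: measurable_funX; exact: measurable_sample_deviation.
apply: (le_trans (@Delta_le_series _ _ _ _ mu n X t g n0 (ltW t0) _ g0 _)).
- by move=> j; exact: measurable_funM.
- move=> j w; rewrite /g -/S -[S j w ^+ 2]real_normK ?num_real//.
  exact: le_add_sqr_div.
apply: (@le_trans _ _ (n%:R^-1 * (t + t^-1 * 48 * W))%:E).
  rewrite EFinM; apply: lee_pmul => //.
    rewrite adde_ge0 ?lee_fin ?(ltW t0)//; apply: nneseries_ge0 => j _ _.
    by apply: integral_ge0 => w _; rewrite lee_fin.
  rewrite [leRHS]EFinD leeD2l// EFinM -sumW -nneseriesZl; last first.
    by move=> j _; rewrite lee_fin.
  apply: lee_nneseries => j _.
    by move=> _; apply: integral_ge0 => w _; rewrite lee_fin.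
  rewrite /g; under eq_integral do rewrite EFinM.
  rewrite ge0_integralZl_EFin ?invr_ge0 ?(ltW t0)//; last 2 first.
  - by move=> w _; rewrite lee_fin sqr_ge0.
  - exact/measurable_EFinP.
  rewrite EFinM -muleA; apply: lee_wpmul2l; first by rewrite lee_fin invr_ge0 ltW.
  exact: integral_sample_deviation_sqr_le.
rewrite -EFinD lee_fin.
have h : t^-1 * W <= Num.sqrt W.
  rewrite ler_pdivrMl// -{1}[W]sqr_sqrtr// expr2 ler_wpM2r ?sqrtr_ge0//.
  by rewrite /t lerDl ltW.
have : n%:R^-1 * (t + t^-1 * 48 * W) <= n%:R^-1 * (49 * Num.sqrt W + n%:R * e).
  rewrite ler_wpM2l// /t -/t; move: h; rewrite {2 3}/t.
  rewrite [t^-1 * 48]mulrC -mulrA; lra.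
move=> /le_trans; apply; rewrite mulrDr mulKf; first lra.
by rewrite pnatr_eq0 -lt0n.
Qed.

(** The rate makes e^{l_j} = 2(j+1), the inverse of the assumed bound on n sigma^2, so the variance
    part of the exponent is at most 1. The threshold 2 contributes (2(j+1))^{-2} <= (j+2)^{-2}. *)
Lemma Delta_le_inv :
  (forall j, sigma2 mu j <= (2 * n%:R * j.+1%:R)^-1) ->
  (Delta mu X <= (18 * n%:R^-1)%:E)%E.
Proof.
move=> s2.
have nR0 : 0 < n%:R :> R by rewrite ltr0n.
pose a (j : nat) : R := 2 * j.+1%:R.
have a0 j : 0 < a j by rewrite mulr_gt0// ltr0n.
have a2 j : 2 <= a j by rewrite /a ler_peMr// ler1n.
pose l j := ln (a j).
have l2 j : 2^-1 <= l j.
  by apply: (le_trans (ln2_ge_half R)); rewrite ler_ln ?posrE.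
have l0 j : 0 < l j by apply: lt_le_trans (l2 j).
(* K = 8 is the product of 1/l_j <= 2 and e <= 4. *)
have := @Delta_le_expR _ _ _ _ mu n X 2 8 l iidX n0 (ler0n _ _) l0.
rewrite (_ : n%:R^-1 * (2 + 2 * 8) = 18 * n%:R^-1); last by rewrite mulrC; congr (_ * _); lra.
apply => j.
have vpsi : n%:R * sigma2 mu j * (expR (l j) - 1 - l j) <= 1.
  apply: (@le_trans _ _ (n%:R * sigma2 mu j * a j)).
    rewrite ler_wpM2l//; first by rewrite mulr_ge0// sigma2_ge0.
    by rewrite lnK ?posrE//; have := l0 j; lra.
  have -> : n%:R * sigma2 mu j * a j = sigma2 mu j * (2 * n%:R * j.+1%:R).
    by rewrite /a; ring.
  by rewrite -ler_pdivlMr ?div1r// !mulr_gt0// ltr0n.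
have e1 : expR (n%:R * sigma2 mu j * (expR (l j) - 1 - l j) - l j * 2) <=
    4 * (j.+2%:R ^+ 2)^-1.
  rewrite expRD; apply: ler_pM; rewrite ?expR_ge0//.
    by apply: le_trans (expR1_le4 R); rewrite ler_expR.
  rewrite expRN mulr_natr mulr2n expRD lnK ?posrE// -expr2 lef_pV2 ?posrE ?exprn_gt0//.
  rewrite lerXn2r ?nnegrE ?(ltW (a0 j))// /a -natrM ler_nat mulnS add2n !ltnS leq_pmull//.
have -> : 8 * (j.+2%:R ^+ 2)^-1 = 2 * (4 * (j.+2%:R ^+ 2)^-1) :> R.
  by rewrite mulrA; congr (_ * _); lra.
apply: ler_pM => //; rewrite ?expR_ge0 ?invr_ge0 ?(ltW (l0 j))//.
by rewrite -[leRHS]invrK lef_pV2 ?posrE.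
Qed.

End small_variances.

(** Used with v = n sigma^2 and T = n M. The two upper bounds given by T match the Poisson range v
    <= L and the Gaussian range v > L, where L = ln(j+2). *)
Lemma exists_expR_rate (R : realType) (v T : R) (j : nat) :
  0 <= v -> 4^-1 <= T -> Num.sqrt (v * ln j.+2%:R) <= T ->
  (v != 0 -> ln j.+2%:R <= T * ln (2 + ln j.+2%:R / v)) ->
  exists l, 0 < l /\
    l^-1 * expR (v * (expR l - 1 - l) - l * (5 * T)) <=
    8 * T * (j.+2%:R ^+ 2)^-1.
Proof.
move=> v0 T4 sT lT; set L := ln j.+2%:R in sT lT *.
have T0 : 0 < T by lra.
have jE : expR (- (2 * L)) = (j.+2%:R ^+ 2)^-1.
  by rewrite expRN expRM_natl lnK ?posrE// ltr0n.
have L2 : 2^-1 <= L.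
  by apply: (le_trans (ln2_ge_half R)); rewrite ler_ln ?posrE ?ler_nat// ltr0n.
have [v00|vn0] := eqVneq v 0.
  (* At zero variance every rate is admissible; this one is just large enough. *)
  exists (j.+2%:R ^+ 2 / T); rewrite divr_gt0 ?exprn_gt0 ?ltr0n//; split => //.
  rewrite v00 mul0r sub0r invf_div [8 * T]mulrC -!mulrA ler_pM2l//.
  rewrite mulrC ler_pM2r ?invr_gt0 ?exprn_gt0 ?ltr0n//.
  apply: (@le_trans _ _ 1); last by lra.
  by rewrite expR_le1 oppr_le0 !mulr_ge0 ?invr_ge0 ?(ltW T0)// sqr_ge0.
have vp : 0 < v by rewrite lt_neqAle eq_sym vn0.
(* An exponent of at most -2L supplies the factor (j+2)^{-2}, leaving 1/l to be absorbed by 8T. *)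
suff : exists l, [/\ 0 < l, l^-1 <= 8 * T &
    v * (expR l - 1 - l) - l * (5 * T) <= - (2 * L)].
  move=> [l [l0 lT8 le]]; exists l; split=> //.
  by rewrite -jE; apply: ler_pM; rewrite ?expR_ge0 ?invr_ge0 ?(ltW l0)// ler_expR.
have [vL|Lv] := leP v L.
  (* With this l, v psi(l) = v (1 - l) + L <= 2L, while l T >= L makes the threshold subtract at
     least 5L. Also 1/l <= 2 <= 8T because T >= 1/4. *)
  exists (ln (2 + L / v)).
  have Lv0 : 0 <= L / v by rewrite divr_ge0; lra.
  have l2 : 2^-1 <= ln (2 + L / v).
    by apply: (le_trans (ln2_ge_half R)); rewrite ler_ln ?posrE//; lra.
  have := lT vn0; rewrite lnK ?posrE; last lra.
  set l := ln _ in l2 * => hT; split; first lra.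
    have l0 : 0 < l by lra.
    apply: (@le_trans _ _ 2); last lra.
    by rewrite -[leRHS]invrK lef_pV2 ?posrE.
  have e : v * (2 + L / v - 1 - l) = v * (1 - l) + L by field; lra.
  rewrite e; nra.
(* Now s <= 1, so v psi(s) <= 2 v s^2 = 2L. Since T >= sqrt(v L) = v s, the threshold subtracts at
   least 5L, and s T >= L >= 1/2 bounds 1/s. *)
pose s := Num.sqrt (L / v).
have L0 : 0 < L by lra.
have s0 : 0 < s by rewrite sqrtr_gt0 divr_gt0.
have ss : s ^+ 2 = L / v by rewrite sqr_sqrtr// divr_ge0// ltW.
have vs : v * s ^+ 2 = L by rewrite ss; field; lra.
have s1 : s <= 1.
  by rewrite -sqrtr1 ler_sqrt// ler_pdivrMr// mul1r ltW.
have sE : Num.sqrt (v * L) = v * s.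
  have -> : v * L = (v * s) ^+ 2 by rewrite exprMn -[in LHS]vs; ring.
  by rewrite sqrtr_sqr ger0_norm// mulr_ge0// ltW.
rewrite sE in sT; exists s; split => //.
  rewrite -[leLHS]mul1r ler_pdivrMr//; nra.
have h : expR s - 1 - s <= 2 * s ^+ 2 by apply: expR_remainder_le; rewrite (ltW s0).
have : v * (expR s - 1 - s) <= 2 * L by rewrite -vs; nra.
nra.
Qed.

(** The threshold n alone suffices, with no series: each of the n summands is at most 1 in absolute
    value. *)
Lemma Delta_le1 d (Omega : measurableType d) (R : realType)
    (P : probability Omega R) (mu : probability (cube R) R) (n : nat)
    (X : 'I_n -> {RV P >-> cube R}) :
  (0 < n)%N -> (Delta mu X <= 1)%E.
Proof.
move=> n0.
have nR0 : 0 < n%:R :> R by rewrite ltr0n.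
have := @Delta_le_series _ _ _ P mu n X n%:R (fun _ _ => 0) n0 (ler0n _ _).
rewrite eseries0; last by move=> *; rewrite integral0.
rewrite adde0 -EFinM mulVf ?gt_eqF//; apply => // j w.
rewrite addr0 (le_trans (ler_norm_sum _ _ _))//.
apply: (@le_trans _ _ (\sum_(i < n) 1)).
  by apply: ler_sum => i _; exact: deviation_le1.
by rewrite sumr_const card_ord.
Qed.

Lemma Delta_le_sup d (Omega : measurableType d) (R : realType)
    (P : probability Omega R) (mu : probability (cube R) R) (n : nat)
    (X : 'I_n -> {RV P >-> cube R}) (M : R) :
  iid_samples mu X -> (0 < n)%N ->
  ~ (forall j : nat, sigma2 mu j <= (2 * n%:R * j.+1%:R)^-1) ->
  (forall j, Num.max (Num.sqrt (sigma2 mu j * ln j.+2%:R / n%:R))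
                    (poisson_term n (sigma2 mu j) j) <= M) ->
  (Delta mu X <= (21 * M)%:E)%E.
Proof.
move=> iidX n0 /existsNP[j0 /negP]; rewrite -ltNge => s0 supM.
have nR0 : 0 < n%:R :> R by rewrite ltr0n.
have L0 j : 0 < ln j.+2%:R :> R.
  apply: (lt_le_trans _ (_ : ln 2 <= _)); first by have := ln2_ge_half R; lra.
  by rewrite ler_ln ?posrE ?ler_nat// ltr0n.
have lnp j s : 0 <= s -> 0 < ln (2 + ln j.+2%:R / (n%:R * s)) :> R.
  move=> s0'; rewrite ln_gt0//.
  suff : 0 <= ln j.+2%:R / (n%:R * s) by lra.
  by rewrite divr_ge0 ?mulr_ge0// ?(ltW (L0 j))// ltW.
pose T := n%:R * M.
(* At zero variance [poisson_term] is 0 and carries no information on the logarithm. *)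
have pT j : sigma2 mu j != 0 ->
    ln j.+2%:R <= T * ln (2 + ln j.+2%:R / (n%:R * sigma2 mu j)).
  move=> sn0; have := supM j; rewrite ge_max => /andP[_].
  rewrite /poisson_term (negbTE sn0) ler_pdivrMr.
    by rewrite mulrCA mulrA.
  by rewrite mulr_gt0// lnp// sigma2_ge0.
have qT j : Num.sqrt (n%:R * sigma2 mu j * ln j.+2%:R) <= T.
  have := supM j; rewrite ge_max => /andP[+ _].
  rewrite -(ler_pM2l nR0) -/T; apply: le_trans.
  rewrite -[X in _ <= X * _](ger0_norm (ltW nR0)) -sqrtr_sqr -sqrtrM ?sqr_ge0//.
  by rewrite ler_wsqrtr// le_eqVlt; apply/orP; left; apply/eqP; field; lra.
(* At the index j0 violating the bound of case (i), 1/v <= 2(j0+1) and L <= j0+1, so 2 + L/v <= 2 +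
   2(j0+1)^2 <= (j0+2)^4. Hence the logarithm in the Poisson term is at most 4L, and that term
   forces T >= 1/4. *)
have T4 : 4^-1 <= T.
  have s00 : 0 < sigma2 mu j0.
    by apply: le_lt_trans s0; rewrite invr_ge0 !mulr_ge0.
  have := pT j0; rewrite gt_eqF// => /(_ isT).
  set L := ln j0.+2%:R; set q := ln (2 + _).
  have q0 : 0 < q by apply: lnp; apply: ltW.
  suff : q <= 4 * L by have := L0 j0; rewrite -/L; nra.
  have -> : 4 * L = ln ((j0.+2%:R ^+ 2) ^+ 2).
    by rewrite -exprM lnXn ?ltr0n// mulr_natl.
  rewrite ler_ln ?posrE ?exprn_gt0 ?ltr0n//; last first.
    suff : 0 <= L / (n%:R * sigma2 mu j0) by lra.
    by rewrite divr_ge0 ?mulr_ge0// ?(ltW (L0 j0))// ltW.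
  have h1 : L <= j0.+1%:R.
    rewrite /L -[j0.+2]add1n natrD le_ln1Dx//.
    by apply: (@lt_le_trans _ _ 0) => //; lra.
  have h2 : (n%:R * sigma2 mu j0)^-1 <= 2 * j0.+1%:R.
    rewrite -[leRHS]invrK lef_pV2 ?posrE ?invr_gt0 ?mulr_gt0 ?ltr0n//.
    rewrite -ler_pdivrMl// -invfM; apply: le_trans (ltW s0).
    by rewrite mulrA [n%:R * 2]mulrC.
  have h3 : L / (n%:R * sigma2 mu j0) <= j0.+1%:R * (2 * j0.+1%:R).
    by apply: ler_pM => //; rewrite ?invr_ge0 ?mulr_ge0 ?(ltW (L0 j0)) ?(ltW s00).
  apply: (@le_trans _ _ (2 + j0.+1%:R * (2 * j0.+1%:R))); first lra.
  rewrite -[j0.+2]addn1 natrD; set a : R := j0.+1%:R.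
  have a1 : 1 <= a by rewrite ler1n.
  have : (a + 1) ^+ 2 >= 4 by nra.
  move=> h; apply: (@le_trans _ _ (4 * (a + 1) ^+ 2)); first nra.
  by rewrite [leRHS]expr2 ler_wpM2r// sqr_ge0.
have v0 j : 0 <= n%:R * sigma2 mu j by rewrite mulr_ge0// sigma2_ge0.
have /choice[l lP] j : exists l, 0 < l /\
    l^-1 * expR (n%:R * sigma2 mu j * (expR l - 1 - l) - l * (5 * T)) <=
    8 * T * (j.+2%:R ^+ 2)^-1.
  apply: exists_expR_rate => //.
  by rewrite mulf_eq0 negb_or => /andP[_]; exact: pT.
(* Threshold 5T and K = 8T give 5 + 2 * 8 = 21. *)
have -> : 21 * M = n%:R^-1 * (5 * T + 2 * (8 * T)).
  by rewrite /T; field; lra.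
apply: (@Delta_le_expR _ _ _ _ mu n X (5 * T) (8 * T) l) => //.
- by lra.
- by move=> j; case: (lP j).
- by move=> j; case: (lP j).
Qed.

Theorem corollary6 (R : realType) :
  exists C : R, 0 < C /\
  forall (n : nat) (mu : probability (cube R) R)
    (d : measure_display) (Omega : measurableType d) (P : probability Omega R)
    (X : 'I_n -> {RV P >-> cube R}),
  (1 <= n)%N ->
  nonincreasing_seq (sigma2 mu) ->
  iid_samples mu X ->
  ((forall j : nat, sigma2 mu j <= (2 * n%:R * j.+1%:R)^-1) ->
    (Delta mu X <= C%:E *
      mine (n%:R^-1)%:E
        (sqrte ((\sum_(0 <= j <oo) (sigma2 mu j)%:E) * (n%:R^-1)%:E)))%E) /\
  (~ (forall j : nat, sigma2 mu j <= (2 * n%:R * j.+1%:R)^-1) ->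
    (Delta mu X <= C%:E *
      mine 1
        (ereal_sup (range (fun j : nat =>
           (Num.max (Num.sqrt (sigma2 mu j * ln j.+2%:R / n%:R))
                    (poisson_term n (sigma2 mu j) j))%:E))))%E).
Proof.
(* The largest of the constants 18, 49, 1 and 21 of the four bounds. *)
exists 49; split=> // n mu d Omega P X n0 _ iidX.
have nR0 : 0 < n%:R :> R by rewrite ltr0n.
split=> [small|large]; rewrite /mine; case: ifPn => _.
- apply: (le_trans (Delta_le_inv iidX n0 small)).
  by rewrite -EFinM lee_fin ler_wpM2r ?invr_ge0// ler_nat.
- have : (0 <= \sum_(0 <= j <oo) (sigma2 mu j)%:E)%E.
    by apply: nneseries_ge0 => j _ _; rewrite lee_fin sigma2_ge0.
  (* An infinite sum of variances makes the right side infinite. *)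
  case sumE : (\sum_(0 <= j <oo) (sigma2 mu j)%:E)%E => [W| |]// W0; last first.
    by rewrite mulyr gtr0_sg ?invr_gt0// mul1e/= mulry gtr0_sg// mul1e leey.
  rewrite (_ : (49%:E * sqrte _)%E = (49 * Num.sqrt (W / n%:R))%:E)//.
  (* [Delta_le_sqrt_sum] is stated for the sum of the n sigma^2(j), which is n W here. *)
  have -> : Num.sqrt (W / n%:R) = n%:R^-1 * Num.sqrt (n%:R * W).
    rewrite -[X in _ = X * _](@ger0_norm _ (n%:R^-1)) ?invr_ge0// -sqrtr_sqr.
    by rewrite -sqrtrM ?sqr_ge0//; congr Num.sqrt; field; lra.
  apply: Delta_le_sqrt_sum => //.
    move=> j; have := small j; rewrite -(ler_pM2l nR0) => /le_trans; apply.
    rewrite -mulrA invfM mulrCA [X in _ * X](_ : _ = j.+1%:R^-1).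
      by rewrite ler_piMr// invf_le1 ?ltr0n// ler1n.
    by rewrite invfM mulVKf ?gt_eqF//.
  under eq_eseriesr do rewrite EFinM.
  by rewrite nneseriesZl ?sumE// => j _; rewrite lee_fin sigma2_ge0.
- apply: (le_trans (Delta_le1 mu X n0)).
  by rewrite mule1 lee_fin ler1n.
set f := (f in range f).
have f_le j : (f j <= ereal_sup (range f))%E by apply: ereal_sup_ubound; exists j.
have f0 : (0 <= f 0%N)%E by rewrite lee_fin le_max sqrtr_ge0.
(* An infinite supremum makes the bound trivial, and -oo is excluded by any single term. *)
case supE : (ereal_sup (range f)) => [M| |].
- have M0 : 0 <= M by rewrite -lee_fin -supE (le_trans f0).
  apply: (le_trans (Delta_le_sup (M := M) iidX n0 large _)) => [j|].
    by rewrite -lee_fin -supE; exact: f_le.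
  by rewrite -EFinM lee_fin ler_wpM2r// ler_nat.
- by rewrite mulry gtr0_sg// mul1e leey.
- by have := f_le 0%N; rewrite supE leeNy_eq.
Qed.
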